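(* Let $k:=\lfloor \epsilon N\rfloor$ and let $M>0$ be a sufficiently large constant (see context). Then $\mathcal{X}_{\mathrm{DR}}(\mathcal{S})$ equals the set of all $\mathbf{x}\in\mathcal{X}$ for which there exist $\mathbf{z}\in\{0,1\}^N$, $\mathbf{r}\in\mathbb{R}^N$ with $\mathbf{r}\ge \mathbf{0}$, and $t\in\mathbb{R}$ with $t\ge 0$ such that \begin{align*} & \epsilon\, t \geq \theta + \frac{1}{N}\sum_{i\in[N]} r_i,\\ & M(1-z_i)\geq t-r_i, && i\in[N],\\ & \frac{\mathbf{b}_p^\top \boldsymbol{\xi}_i+d_p-\mathbf{a}_p^\top\mathbf{x}}{\|\mathbf{b}_p\|_*}+M z_i\geq t-r_i, && i\in[N],\ p\in[P],\\ & \sum_{i\in[N]} z_i\leq k,\\ & \frac{\mathbf{b}_p^\top \boldsymbol{\xi}_i+d_p-\mathbf{a}_p^\top\mathbf{x}}{\|\mathbf{b}_p\|_*}+M z_i\geq 0, && i\in[N],\ p\in[P]. \end{align*} Consequently, minimizing $\mathbf{c}^\top\mathbf{x}$ (for a given $\mathbf{c}\in\mathbb{R}^L$) over $(\mathbf{z},\mathbf{r},t,\mathbf{x})$ subject to these constraints and $\mathbf{x}\in\mathcal{X}$ is an exact reformulation of minimizing $\mathbf{c}^\top\mathbf{x}$ over $\mathbf{x}\in\mathcal{X}_{\mathrm{DR}}(\mathcal{S})$.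
   Context: Notation: $[n]:=\{1,\dots,n\}$. Fix positive integers $K,L,N,P$, a compact set $\mathcal{X}\subset\mathbb{R}^L$, a norm $\|\cdot\|$ on $\mathbb{R}^K$ with dual norm $\|\cdot\|_*$, samples $\boldsymbol{\xi}_1,\dots,\boldsymbol{\xi}_N\in\mathbb{R}^K$, a risk tolerance $\epsilon\in(0,1)$ and a radius $\theta>0$. For $p\in[P]$ let $\mathbf{a}_p\in\mathbb{R}^L$, $\mathbf{b}_p\in\mathbb{R}^K\setminus\{\mathbf{0}\}$, $d_p\in\mathbb{R}$. For $\mathbf{x}\in\mathcal{X}$ the safety set is $$\mathcal{S}(\mathbf{x}):=\{\boldsymbol{\xi}\in\mathbb{R}^K:\ \mathbf{b}_p^\top\boldsymbol{\xi}+d_p-\mathbf{a}_p^\top\mathbf{x}>0,\ p\in[P]\}.$$ Let $\mathbb{P}_N$ be the empirical distribution on $\boldsymbol{\xi}_1,\dots,\boldsymbol{\xi}_N$ (mass $1/N$ on each sample). For distributions $\mathbb{P},\mathbb{P}'$ on $\mathbb{R}^K$, the 1-Wasserstein distance is $$d_W(\mathbb{P},\mathbb{P}'):=\inf_{\Pi}\{\mathbb{E}_{(\boldsymbol{\xi},\boldsymbol{\xi}')\sim\Pi}[\|\boldsymbol{\xi}-\boldsymbol{\xi}'\|]:\ \Pi\text{ has marginal distributions }\mathbb{P},\mathbb{P}'\},$$ and the ambiguity set is $\mathcal{F}_N(\theta):=\{\mathbb{P}: d_W(\mathbb{P}_N,\mathbb{P})\le\theta\}$. The feasible region of the distributionally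 robust chance-constrained program is $$\mathcal{X}_{\mathrm{DR}}(\mathcal{S}):=\Big\{\mathbf{x}\in\mathcal{X}:\ \sup_{\mathbb{P}\in\mathcal{F}_N(\theta)}\mathbb{P}[\boldsymbol{\xi}\notin\mathcal{S}(\mathbf{x})]\le\epsilon\Big\}.$$ ''$M$ sufficiently large'' means: $M>0$ and $M\ge |\mathbf{b}_p^\top\boldsymbol{\xi}_i+d_p-\mathbf{a}_p^\top\mathbf{x}|/\|\mathbf{b}_p\|_*$ for all $\mathbf{x}\in\mathcal{X}$, $i\in[N]$, $p\in[P]$. *)

(* Defs.v *)
(* MathComp / MathComp-Analysis *)
From HB Require Import structures.
From mathcomp Require Import all_boot all_order all_algebra.
From mathcomp Require Import all_classical all_reals all_analysis.

Set Implicit Arguments.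
Unset Strict Implicit.
Unset Printing Implicit Defensive.
Import Order.TTheory GRing.Theory Num.Theory.
Import numFieldNormedType.Exports.

Local Open Scope classical_set_scope.
Local Open Scope ring_scope.

Definition dot {R : realType} {n : nat} (u v : 'rV[R]_n) : R :=
  \sum_(j < n) u 0 j * v 0 j.

(* The canonical norm [`|v|] of ['rV[R]_n] is the sup norm, so an arbitrary norm
   is a function satisfying the axioms below.  The canonical topology of
   ['rV[R]_n] is the topology of every such norm. *)
Record is_norm {R : realType} {n : nat} (nrm : 'rV[R]_n -> R) : Prop := IsNorm {
  is_norm_triangle : forall u v, nrm (u + v) <= nrm u + nrm v;
  is_norm_scale : forall (c : R) u, nrm (c *: u) = `|c| * nrm u;
  is_norm_eq0 : forall u, nrm u = 0 -> u = 0 }.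

Definition dual_norm {R : realType} {n : nat} (nrm : 'rV[R]_n -> R)
    (b : 'rV[R]_n) : R :=
  sup [set dot b u | u in [set u | nrm u <= 1]].

(* ['rV[R]_n] equipped with its Borel sigma-algebra. *)
Notation borelRV R n := (g_sigma_algebraType (@open 'rV[R]_n)).

Section empirical.
Local Open Scope ereal_scope.
Context {R : realType} {K N : nat} (xi : 'I_N -> 'rV[R]_K).

Definition empirical (A : set (borelRV R K)) : \bar R :=
  \sum_(i < N) (N%:R^-1)%:E * \d_(xi i : borelRV R K) A.

Let empirical0 : empirical set0 = 0.
Proof. by rewrite /empirical big1// => i _; rewrite measure0 mule0. Qed.

Let empirical_ge0 A : 0 <= empirical A.
Proof.
by apply: sume_ge0 => i _; apply: mule_ge0 => //; rewrite lee_fin invr_ge0.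
Qed.

Let empirical_sigma_additive : semi_sigma_additive empirical.
Proof.
move=> F mF tF mUF; rewrite [X in _ --> X](_ : _ =
    lim ((fun n => \sum_(0 <= i < n) empirical (F i)) @ \oo)).
  by apply: is_cvg_ereal_nneg_natsum => k _; exact: empirical_ge0.
rewrite nneseries_sum//; last first.
  by move=> i j _; apply: mule_ge0 => //; rewrite lee_fin invr_ge0.
apply: eq_bigr => /= i _; rewrite nneseriesZl//; congr (_ * _).
exact: measure_semi_bigcup.
Qed.

HB.instance Definition _ := isMeasure.Build _ _ _ empirical
  empirical0 empirical_ge0 empirical_sigma_additive.

Lemma empirical_setT : (0 < N)%N -> empirical setT = 1.
Proof.
move=> N0; rewrite /empirical.
under eq_bigr do rewrite diracT mule1.
rewrite sumEFin sumr_const card_ord -(mulr_natr (N%:R^-1)%R) mulVf//.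
by rewrite pnatr_eq0 -lt0n.
Qed.

End empirical.

Section wasserstein.
Context {R : realType} {K : nat}.

Definition couplings (mu nu : {measure set (borelRV R K) -> \bar R}) :
    set (probability (borelRV R K * borelRV R K)%type R) :=
  [set Pi | forall A : set (borelRV R K), measurable A ->
              pushforward Pi fst A = mu A /\ pushforward Pi snd A = nu A].

Definition wasserstein1 (nrm : 'rV[R]_K -> R)
    (mu nu : {measure set (borelRV R K) -> \bar R}) : \bar R :=
  ereal_inf [set (\int[Pi]_w (nrm ((w.1 : 'rV[R]_K) - w.2))%:E)%E
            | Pi in couplings mu nu].

Definition ambiguity_set (N : nat) (nrm : 'rV[R]_K -> R)
    (xi : 'I_N -> 'rV[R]_K) (theta : R) : set (probability (borelRV R K) R) :=
  [set Q | (wasserstein1 nrm (empirical xi) Q <= theta%:E)%E].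

End wasserstein.

Section drccp.
Context {R : realType} {K L N P : nat}.
Variables (X : set 'rV[R]_L) (nrm : 'rV[R]_K -> R) (xi : 'I_N -> 'rV[R]_K).
Variables (eps theta M : R).
Variables (a : 'I_P -> 'rV[R]_L) (b : 'I_P -> 'rV[R]_K) (d : 'I_P -> R).

Definition safety_set (x : 'rV[R]_L) : set (borelRV R K) :=
  [set u | forall p : 'I_P, 0 < dot (b p) u + d p - dot (a p) x].

Definition dr_feasible : set 'rV[R]_L :=
  [set x | X x /\
    (ereal_sup [set Q (~` safety_set x) | Q in ambiguity_set nrm xi theta]
       <= eps%:E)%E].

Definition sufficiently_large : Prop :=
  0 < M /\ forall x, X x -> forall (i : 'I_N) (p : 'I_P),
    `|dot (b p) (xi i) + d p - dot (a p) x| / dual_norm nrm (b p) <= M.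

(* Variables [(z, r, t, x)], with [z i : bool] read as a real in {0, 1}. *)
Definition mip_vars : Type :=
  ({ffun 'I_N -> bool} * 'rV[R]_N * R * 'rV[R]_L)%type.

Definition mip_constraints (z : {ffun 'I_N -> bool}) (r : 'rV[R]_N) (t : R)
    (x : 'rV[R]_L) : Prop :=
  let k : int := Num.floor (eps * N%:R) in
  let margin i p := (dot (b p) (xi i) + d p - dot (a p) x)
                      / dual_norm nrm (b p) in
  [/\ (forall i, 0 <= r 0 i) /\ 0 <= t,
      eps * t >= theta + N%:R^-1 * \sum_(i < N) r 0 i,
      (forall i, M * (1 - (z i)%:R) >= t - r 0 i) /\
      (forall i p, margin i p + M * (z i)%:R >= t - r 0 i),
      \sum_(i < N) (z i)%:R <= k%:~R :> R
    & forall i p, margin i p + M * (z i)%:R >= 0].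

Definition mip_feasible : set mip_vars :=
  [set w | let: (z, r, t, x) := w in X x /\ mip_constraints z r t x].

End drccp.

Section minimization.
Context {R : realType} {T : Type}.

Definition optimal_value (F : set T) (f : T -> R) : \bar R :=
  ereal_inf [set (f w)%:E | w in F].

Definition minimizers (F : set T) (f : T -> R) : set T :=
  [set w | F w /\ forall v, F v -> f w <= f v].

End minimization.

(* Main.v *)
(* Fix [x] and let [D u] be the distance from [u] to the closed set of unsafe
   scenarios, [D u = max 0 (min_p margin_p u)]. Both sides of the theorem are
   equivalent to the existence of [t >= 0] with
   [theta + 1/N \sum_i max 0 (t - D (xi i)) <= eps t].
   If such a [t] exists, integrating
   [t 1_unsafe(w.2) <= nrm (w.1 - w.2) + max 0 (t - D w.1)] against couplings
   bounds the worst-case probability. Otherwise, moving the samples closest to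
   the unsafe set onto it (one group of ties only fractionally) gives a
   finitely supported distribution in the Wasserstein ball that violates the
   chance constraint. *)
Require Import Defs.
From HB Require Import structures.
From mathcomp Require Import all_boot all_order all_algebra.
From mathcomp Require Import all_classical all_reals all_analysis.
From mathcomp Require Import measurable_realfun lra ring.
Set Implicit Arguments.
Unset Strict Implicit.
Unset Printing Implicit Defensive.
Import Order.TTheory GRing.Theory Num.Theory.
Import numFieldNormedType.Exports.
Local Open Scope classical_set_scope.
Local Open Scope ring_scope.

(** * Finitely supported measures and integrals of nonnegative functions *)

Section finitely_supported_measure.
Local Open Scope ereal_scope.
Context d (T : measurableType d) (R : realType) (I : finType).
Variables (w : I -> R) (y : I -> T).
Hypothesis w_ge0 : forall i, (0 <= w i)%R.

(** Provides both the adversarial distribution and its coupling with the empirical measure. *)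
Lemma exists_finitely_supported : (\sum_i w i = 1)%R ->
  exists Q : probability T R, forall A, Q A = \sum_i (w i)%:E * \d_(y i) A.
Proof.
move=> w1; pose m (A : set T) := \sum_i (w i)%:E * \d_(y i) A : \bar R.
have m0 : m set0 = 0 by rewrite /m big1// => i _; rewrite measure0 mule0.
have m_ge0 A : 0 <= m A.
  by apply: sume_ge0 => i _; rewrite mule_ge0// lee_fin.
have m_sigma : semi_sigma_additive m.
  move=> F mF tF mUF; rewrite [X in _ --> X](_ : _ =
      lim ((fun n => \sum_(0 <= k < n) m (F k)) @ \oo)).
    by apply: is_cvg_ereal_nneg_natsum => k _; exact: m_ge0.
  rewrite nneseries_sum//; last by move=> i k _; rewrite mule_ge0// lee_fin.
  apply: eq_bigr => /= i _; rewrite nneseriesZl//; congr (_ * _).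
  exact: measure_semi_bigcup.
have mT : m setT = 1.
  rewrite /m; under eq_bigr do rewrite diracT mule1.
  by rewrite sumEFin w1.
pose mu : {measure set T -> \bar R} :=
  HB.pack m (isMeasure.Build _ _ _ m m0 m_ge0 m_sigma).
pose Q : probability T R :=
  HB.pack (Measure.sort mu) (Measure_isProbability.Build _ _ _ mu mT).
by exists Q.
Qed.

Import HBNNSimple.

(* No measurability of [f] is needed, since the integral of a nonnegative
   function is a supremum over the simple functions below it. *)
Lemma integral_finitely_supported_le (mu : {measure set T -> \bar R})
    (f : T -> R) :
  (forall A, measurable A -> mu A = \sum_i (w i)%:E * \d_(y i) A) ->
  (forall u, (0 <= f u)%R) ->
  \int[mu]_u (f u)%:E <= (\sum_i w i * f (y i))%:E.
Proof.
move=> muE f0; rewrite ge0_integralTE; last by move=> u; rewrite lee_fin.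
apply: ge_ereal_sup => _ [h /= hf <-].
have -> : sintegral mu h = \sum_i (w i)%:E * sintegral \d_(y i) h.
  under [RHS]eq_bigr.
    move=> i _; rewrite sintegralE fsbig_finite//= ge0_sume_distrr; last first.
      by move=> r _; exact: nnsfun_mulemu_ge0.
    over.
  rewrite sintegralE fsbig_finite//= exchange_big/=; apply: eq_bigr => r _.
  rewrite muE// ge0_sume_distrr; last first.
    by move=> i _; rewrite mule_ge0// lee_fin.
  by apply: eq_bigr => i _; rewrite muleCA.
rewrite -sumEFin; apply: lee_sum => i _; rewrite EFinM lee_wpmul2l ?lee_fin//.
rewrite -integralT_nnsfun integral_dirac//.
2: exact/measurable_EFinP.
by rewrite diracT mul1e.
Qed.

End finitely_supported_measure.

Section integral_monotonicity.
Local Open Scope ereal_scope.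
Context d (T : measurableType d) (R : realType).
Variable mu : {measure set T -> \bar R}.

Import HBNNSimple.

(** Every simple function below [f] is below [g], so the supremum for [g] runs over a larger set. *)
Lemma ge0_le_integral_nonmeasurable (f g : T -> \bar R) :
  (forall u, 0 <= f u) -> (forall u, f u <= g u) ->
  \int[mu]_u f u <= \int[mu]_u g u.
Proof.
move=> f0 fg; rewrite !ge0_integralTE//; last first.
  by move=> u; exact: le_trans (fg u).
apply: ge_ereal_sup => _ [h /= hf <-]; apply: ereal_sup_ubound.
by exists h => //= u; exact: le_trans (fg u).
Qed.

End integral_monotonicity.

(** * Finite-dimensional duality *)

(* Duality for the fractional knapsack problem: the extremal [t] is a
   quantile of [D], and an optimal [al] is the indicator of [D < t] plus a
   constant fraction of the indicator of [D = t]. *)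
Lemma knapsack_duality (R : realFieldType) (I : finType) (D : I -> R)
    (E Th : R) :
  (forall i, 0 <= D i) -> 0 <= E -> E < #|I|%:R ->
  (forall al : I -> R, (forall i, 0 <= al i <= 1) ->
     \sum_i al i * D i < Th -> \sum_i al i <= E) ->
  exists2 t, 0 <= t & Th + \sum_i Num.max 0 (t - D i) <= E * t.
Proof.
move=> D0 E0 EI alP.
have [i0 _] : exists i0 : I, true.
  have : (0 < #|I|)%N by rewrite -(ltr_nat R) (le_lt_trans E0).
  by move=> /card_gt0P[i _]; exists i.
pose cnt s : R := \sum_i (D i <= s)%R%:R.
pose m := [arg max_(i > i0) D i]%O.
have cntm : E < cnt (D m).
  rewrite (lt_le_trans EI)// /cnt (eq_bigr (fun=> 1)) ?sumr_const//.
  move=> i _; rewrite /m; case: arg_maxP => // k _ /(_ i) kmax.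
  by have -> : D i <= D k by exact: kmax.
(* Among the values of [D], [t] is the least with more than [E] indices at or below it. *)
case: (@arg_minP _ _ _ m (fun j => E < cnt (D j)) D cntm) => j Ej jmin.
set t := D j in Ej jmin.
pose A : R := \sum_i (D i < t)%R%:R; pose B : R := \sum_i (D i == t)%:R.
have ABE : A + B = cnt t.
  rewrite /A /B -big_split; apply: eq_bigr => i _ /=.
  by case: ltgtP; rewrite ?addr0 ?add0r.
have AE : A <= E.
  rewrite leNgt; apply/negP => EA.
  have [l lt_l] : exists l, D l < t.
    apply/existsP; apply: contraLR (lt_le_trans EA (lexx _)) => /existsPn noi.
    by rewrite -leNgt /A big1// => i _; rewrite (negbTE (noi i)).
  (* The largest value below [t] would already count more than [E] indices, against the minimality
     of [t]. *)
  case: (@arg_maxP _ _ _ l (fun i => D i < t) D lt_l) => k kt kmax.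
  have : E < cnt (D k).
    rewrite (lt_le_trans EA)// ler_sum// => i _.
    have [it|//] := boolP (D i < t).
    by have -> : D i <= D k by exact: kmax.
  by move=> /jmin; rewrite leNgt kt.
have B0 : 0 < B by lra.
have t0 : 0 <= t by exact: D0.
exists t => //; rewrite leNgt; apply/negP; set S := \sum_i _ => slack.
(* The first cap on the excess [de] ensures [be <= 1], the second keeps the cost below [Th]; the
   divisor is [t + 1] because [t] may be 0. *)
pose de := Num.min (A + B - E) ((Th + S - E * t) / (t + 1) / 2).
have de0 : 0 < de.
  by rewrite lt_min; apply/andP; split; [lra|rewrite !divr_gt0//; lra].
have deAB : de <= A + B - E by rewrite ge_min lexx.
have det : de * t < Th + S - E * t.
  have : de <= (Th + S - E * t) / (t + 1) / 2 by rewrite ge_min lexx orbT.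
  rewrite ler_pdivlMr// ler_pdivlMr; lra.
pose be := (E - A + de) / B.
have beB : be * B = E - A + de by rewrite /be divfK// gt_eqF.
have be01 : 0 <= be <= 1.
  by rewrite /be divr_ge0 ?(ltW B0)//=; [rewrite ler_pdivrMr//; lra|lra].
(* The total of [al] is [A + be * B = E + de > E], while its cost is [t * (E + de) - S < Th]: this
   contradicts [alP]. *)
pose al i : R := (D i < t)%R%:R + be * (D i == t)%:R.
suff : \sum_i al i <= E.
  by rewrite /al big_split/= -mulr_sumr -/A -/B beB; lra.
apply: alP => [i|].
  by rewrite /al; case: ltgtP; rewrite /= ?mulr1 ?mulr0 ?addr0 ?add0r ?lexx ?ler01.
have -> : \sum_i al i * D i = A * t - S + be * t * B.
  rewrite /A /B /S mulr_suml mulr_sumr -sumrB -big_split; apply: eq_bigr => i _.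
  rewrite /al /=; case: ltgtP => [Dt|tD|->]; rewrite /= ?mulr1n ?mulr0n.
  - by rewrite max_r ?subr_ge0 ?ltW//; ring.
  - by rewrite max_l ?subr_le0 ?ltW//; ring.
  - by rewrite subrr maxxx; ring.
have -> : be * t * B = t * (be * B) by ring.
by rewrite beB; lra.
Qed.

(** * Norms and dual norms on a finite-dimensional space *)

Section norms.
Context {R : realType} {n : nat}.
Implicit Types u v b : 'rV[R]_n.

Lemma dotDr b u v : dot b (u + v) = dot b u + dot b v.
Proof. by rewrite /dot -big_split/=; apply: eq_bigr => j _; rewrite mxE mulrDr. Qed.

Lemma dotZr b (c : R) u : dot b (c *: u) = c * dot b u.
Proof. by rewrite /dot mulr_sumr; apply: eq_bigr => j _; rewrite mxE mulrCA. Qed.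

Lemma dotNr b u : dot b (- u) = - dot b u.
Proof. by rewrite -scaleN1r dotZr mulN1r. Qed.

Lemma dotBr b u v : dot b (u - v) = dot b u - dot b v.
Proof. by rewrite dotDr dotNr. Qed.

Lemma dot_self_gt0 b : b != 0 -> 0 < dot b b.
Proof.
move=> b0; rewrite lt_neqAle sumr_ge0 ?andbT; last by move=> j _; rewrite -expr2 sqr_ge0.
apply: contra b0 => /eqP /esym bb0; apply/eqP/rowP => j; rewrite mxE.
have := psumr_eq0P (fun j _ => sqr_ge0 (b 0 j)) bb0.
by move=> /(_ j isT)/eqP; rewrite sqrf_eq0 => /eqP.
Qed.

Lemma dot_continuous b : continuous (dot b).
Proof.
apply: continuous_big => [|j _ u]; first exact: add_continuous.
by move=> *; exact: (continuousM (@cst_continuous _ _ (b 0 j) u)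
  (@coord_continuous R 1 n 0 j u)).
Qed.

Variable nrm : 'rV[R]_n -> R.
Hypothesis nrmP : is_norm nrm.

Lemma is_norm0 : nrm 0 = 0.
Proof. by rewrite -(scale0r 0) is_norm_scale// normr0 mul0r. Qed.

Lemma is_normN u : nrm (- u) = nrm u.
Proof. by rewrite -scaleN1r is_norm_scale// normrN1 mul1r. Qed.

Lemma is_norm_ge0 u : 0 <= nrm u.
Proof.
have := is_norm_triangle nrmP u (- u).
by rewrite subrr is_norm0 is_normN -mulr2n pmulrn_lge0.
Qed.

Lemma is_norm_gt0 u : u != 0 -> 0 < nrm u.
Proof.
move=> u0; rewrite lt_neqAle is_norm_ge0 andbT eq_sym.
by apply: contra u0 => /eqP/(is_norm_eq0 nrmP)/eqP.
Qed.

Lemma is_norm_sum (I : finType) (F : I -> 'rV[R]_n) :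
  nrm (\sum_i F i) <= \sum_i nrm (F i).
Proof.
elim/big_ind2 : _ => //; first by rewrite is_norm0.
by move=> u s v t us vt; rewrite (le_trans (is_norm_triangle nrmP _ _)) ?lerD.
Qed.

(** Expand [u] in the unit vectors; [C] is the sum of their norms. *)
Lemma is_norm_le_sup : exists2 C, 0 <= C & forall u, nrm u <= C * `|u|.
Proof.
exists (\sum_j nrm (delta_mx 0 j)).
  by apply: sumr_ge0 => j _; exact: is_norm_ge0.
move=> u; rewrite {1}(row_sum_delta u) (le_trans (is_norm_sum _))//.
rewrite mulr_suml ler_sum// => j _; rewrite is_norm_scale// mulrC.
rewrite ler_wpM2l ?is_norm_ge0// [leRHS]/Num.Def.normr/= mx_normrE.
by apply/bigmax_geP; right => /=; exists (0, j).
Qed.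

Lemma is_norm_continuous : continuous nrm.
Proof.
have [C C0 nC] := is_norm_le_sup.
move=> u; rewrite /continuous_at.
apply/(@cvgrPdist_le _ _ _ (nbhs u) (nbhs_filter u)) => /= e e0.
have C1 : 0 < C + 1 by rewrite ltr_wpDl.
have := nbhsx_ballx u (e / (C + 1)) (divr_gt0 e0 C1).
apply: (@filterS _ _ (nbhs_filter u)) => v; rewrite -ball_normE => /ltW uv.
have : `|nrm u - nrm v| <= nrm (u - v).
  rewrite ler_norml; apply/andP; split.
    have := is_norm_triangle nrmP (v - u) u.
    by rewrite subrK -opprB is_normN; lra.
  by have := is_norm_triangle nrmP (u - v) v; rewrite subrK; lra.
move=> /le_trans; apply; rewrite (le_trans (nC _))//.
apply: (@le_trans _ _ ((C + 1) * `|u - v|)).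
  by rewrite ler_wpM2r// lerDl.
by rewrite -ler_pdivlMl// mulrC.
Qed.

(* Equivalence of norms, by compactness of the unit sphere of the sup norm. *)
Lemma sup_le_is_norm : exists2 c, 0 < c & forall u, c * `|u| <= nrm u.
Proof.
pose S := [set u : 'rV[R]_n | `|u| = 1].
(* If the sphere is empty (dimension 0), every vector is 0 and the constant 1 works. *)
have [[v0 Sv0]|S0] := pselect (S !=set0); last first.
  exists 1 => // u; have [->|u0] := eqVneq u 0.
    by rewrite normr0 mulr0 is_norm0.
  case: S0; exists (`|u|^-1 *: u).
  by rewrite /S/= normrZ normfV normr_id mulVf// normr_eq0.
have cS : compact S.
  apply: bounded_closed_compact.
    by exists 1; split => // r r1 u /= ->; exact: ltW.
  apply: (@preimage_closed _ _ (fun u : 'rV[R]_n => `|u|) [set 1]) => [u _|].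
    exact: norm_continuous.
  exact: closed_eq.
have [|v /set_mem/= Sv vmin] := EVT_min_rV (ex_intro _ v0 Sv0) cS (f := nrm).
  by apply: continuous_subspaceT; exact: is_norm_continuous.
exists (nrm v) => [|u].
  by rewrite is_norm_gt0// -normr_gt0 Sv.
have [->|u0] := eqVneq u 0; first by rewrite normr0 mulr0 is_norm0.
have nu : 0 < `|u| by rewrite normr_gt0.
have /mem_set/vmin : S (`|u|^-1 *: u).
  by rewrite /S/= normrZ normfV normr_id mulVf// gt_eqF.
by rewrite is_norm_scale// normfV normr_id ler_pdivlMl// mulrC.
Qed.

(** By equivalence of norms, coordinates are bounded on the unit ball. Thus [sup] in [dual_norm] is
    a true supremum, not a default value. *)
Lemma dual_norm_has_sup b : has_sup [set dot b u | u in [set u | nrm u <= 1]].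
Proof.
split; first by exists (dot b 0), 0 => //=; rewrite is_norm0.
have [c c0 cn] := sup_le_is_norm.
exists ((\sum_j `|b 0 j|) / c) => _ [u /= u1 <-].
rewrite mulr_suml ler_sum// => j _.
rewrite (le_trans (ler_norm _))// normrM ler_wpM2l//.
rewrite -[leRHS]mul1r ler_pdivlMr// mulrC (le_trans _ u1)// (le_trans _ (cn _))//.
rewrite ler_wpM2l ?(ltW c0)// [leRHS]/Num.Def.normr/= mx_normrE.
by apply/bigmax_geP; right => /=; exists (0, j).
Qed.

(** Hölder's inequality for dual norms, by scaling [u] to norm 1. *)
Lemma dot_le_dual_norm b u : dot b u <= dual_norm nrm b * nrm u.
Proof.
have [->|u0] := eqVneq u 0.
  by rewrite is_norm0 mulr0 -(scale0r 0) dotZr mul0r.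
rewrite -ler_pdivrMr ?is_norm_gt0// mulrC -dotZr.
apply: sup_upper_bound; first exact: dual_norm_has_sup.
exists ((nrm u)^-1 *: u) => //=.
rewrite is_norm_scale// ger0_norm ?invr_ge0 ?is_norm_ge0//.
by rewrite mulVf// gt_eqF// is_norm_gt0.
Qed.

Lemma dual_norm_gt0 b : b != 0 -> 0 < dual_norm nrm b.
Proof.
move=> b0; have := lt_le_trans (dot_self_gt0 b0) (dot_le_dual_norm b b).
by rewrite pmulr_lgt0// is_norm_gt0.
Qed.

Lemma dual_norm_adherent b c : c < dual_norm nrm b ->
  exists2 u, nrm u <= 1 & c < dot b u.
Proof.
move=> cb; have [|_ [u u1 <-] cu] := @sup_gt _ _ c _ cb; last by exists u.
by case: (dual_norm_has_sup b).
Qed.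

End norms.

Lemma continuous_borelRV_measurable (R : realType) (n : nat)
    (f : 'rV[R]_n -> R) :
  continuous f -> measurable_fun [set: borelRV R n] f.
Proof.
move=> /continuousP cf; apply: (measurability _ (RGenOpens.measurableE R)).
move=> _ [_ [a [b ->] <-]]; rewrite setTI; apply: sub_sigma_algebra.
exact/cf/interval_open.
Qed.

(** * Distance to the unsafe set *)

Section distance_to_unsafe_set.
Context {R : realType} {K L P : nat}.
Variables (nrm : 'rV[R]_K -> R) (a : 'I_P -> 'rV[R]_L) (b : 'I_P -> 'rV[R]_K).
Variables (d : 'I_P -> R) (x : 'rV[R]_L) (p0 : 'I_P).
Hypotheses (nrmP : is_norm nrm) (b_neq0 : forall p, b p != 0).
Implicit Types (u v : 'rV[R]_K) (p : 'I_P).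

(** Signed distance from [u] to the hyperplane of constraint [p], positive on the safe side. *)
Definition margin u p : R :=
  (dot (b p) u + d p - dot (a p) x) / dual_norm nrm (b p).

(** The minimum is seeded with [margin u p0], itself one of its terms, so the seed does not change
    the value. *)
Definition unsafe_dist u : R :=
  Num.max 0 (\big[Num.min/margin u p0]_p margin u p).

Notation unsafe := (~` safety_set a b d x).

(** Division by the dual norm makes each margin 1-Lipschitz for [nrm]. *)
Lemma margin_le u v p : margin u p <= margin v p + nrm (u - v).
Proof.
have bp := dual_norm_gt0 nrmP (b_neq0 p).
rewrite /margin -lerBlDl -mulrBl ler_pdivrMr// mulrC.
by rewrite (le_trans _ (dot_le_dual_norm nrmP _ _))// dotBr; lra.
Qed.

Lemma unsafeP v : unsafe v <-> exists p, margin v p <= 0.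
Proof.
split=> [/existsNP[p /negP]|[p]].
  rewrite -leNgt => vp; exists p.
  by rewrite /margin pmulr_lle0// invr_gt0 dual_norm_gt0.
rewrite /margin pmulr_lle0 ?invr_gt0 ?dual_norm_gt0// => vp /(_ p).
by rewrite ltNge vp.
Qed.

Lemma unsafe_dist_ge0 u : 0 <= unsafe_dist u.
Proof. by rewrite /unsafe_dist le_max lexx. Qed.

Lemma unsafe_dist_le_margin u p : unsafe_dist u <= Num.max 0 (margin u p).
Proof.
rewrite /unsafe_dist ge_max le_max lexx/= le_max; apply/orP; right.
exact: bigmin_le.
Qed.

Lemma unsafe_dist_attained u : exists p, unsafe_dist u = Num.max 0 (margin u p).
Proof.
pose p := [arg min_(p < p0) margin u p]%O.
exists p; congr Num.max; apply/le_anti; rewrite bigmin_le/=.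
rewrite /p; case: arg_minP => // q _ qmin.
by apply: le_bigmin => [|r _]; exact: qmin.
Qed.

Lemma unsafe_dist_le v u : unsafe v -> unsafe_dist u <= nrm (u - v).
Proof.
move=> /unsafeP[p vp]; rewrite (le_trans (unsafe_dist_le_margin u p))//.
rewrite ge_max is_norm_ge0//= (le_trans (margin_le u v p))//.
by rewrite gerDr.
Qed.

Lemma unsafe_dist_le0 u : unsafe_dist u <= 0 <-> unsafe u.
Proof.
split=> [|/unsafe_dist_le -/(_ u)]; last by rewrite subrr is_norm0.
have [p ->] := unsafe_dist_attained u.
by rewrite ge_max lexx/= => up; apply/unsafeP; exists p.
Qed.

(** Move from [u] to the hyperplane of a closest constraint along a direction that nearly attains
    the dual norm; near-attainment costs the excess [e]. *)
Lemma unsafe_dist_adherent u e : 0 < e ->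
  exists2 v, unsafe v & nrm (u - v) <= unsafe_dist u + e.
Proof.
move=> e0; have [p ->] := unsafe_dist_attained u.
have [up|up] := leP (margin u p) 0.
  exists u; first by apply/unsafeP; exists p.
  by rewrite subrr is_norm0// add0r ltW.
have bp := dual_norm_gt0 nrmP (b_neq0 p).
set c := margin u p in up *.
(* The threshold is below the dual norm as [c < c + e], and it makes the step length used below less
   than [c + e]. *)
have [|v v1 cv] := @dual_norm_adherent _ _ _ nrmP (b p)
    (c * dual_norm nrm (b p) / (c + e)).
  by rewrite ltr_pdivrMr ?addr_gt0// mulrC ltr_pM2l// ltrDl.
have cb0 : 0 < c * dual_norm nrm (b p) by rewrite mulr_gt0.
have bv0 : 0 < dot (b p) v by rewrite (lt_trans _ cv)// divr_gt0// addr_gt0.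
have cE : c * dual_norm nrm (b p) = dot (b p) u + d p - dot (a p) x.
  by rewrite /c /margin divfK// gt_eqF.
(* This step length brings the margin for [p] to exactly 0, which counts as unsafe. *)
exists (u - (c * dual_norm nrm (b p) / dot (b p) v) *: v).
  apply/unsafeP; exists p; rewrite /margin dotBr dotZr divfK ?gt_eqF//.
  by rewrite cE [X in X / _](_ : _ = 0) ?mul0r//; ring.
rewrite opprB addrC subrK is_norm_scale// gtr0_norm ?divr_gt0//.
rewrite (le_trans (ler_piMr _ v1)) ?divr_ge0 ?(ltW cb0) ?(ltW bv0)//.
by rewrite ltW// ltr_pdivrMr// [ltRHS]mulrC -ltr_pdivrMr ?addr_gt0//.
Qed.

Lemma measurable_margin p : measurable_fun [set: borelRV R K] (margin ^~ p).
Proof.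
apply: measurable_funM => //; apply: measurable_funB => //.
apply: measurable_funD => //.
by apply: continuous_borelRV_measurable; exact: dot_continuous.
Qed.

Lemma measurable_unsafe_dist : measurable_fun [set: borelRV R K] unsafe_dist.
Proof.
apply: measurable_maxr => //.
elim: (index_enum _) => [|p s IH].
  by under eq_fun do rewrite big_nil; exact: measurable_margin.
under eq_fun do rewrite big_cons.
by apply: measurable_minr => //; exact: measurable_margin.
Qed.

Lemma measurable_unsafe : measurable unsafe.
Proof.
rewrite [X in measurable X](_ : _ = unsafe_dist @^-1` `]-oo, 0]); last first.
  by apply/seteqP; split=> u /=; rewrite in_itv/= => /unsafe_dist_le0.
by rewrite -[X in measurable X]setTI; exact: measurable_unsafe_dist.
Qed.

End distance_to_unsafe_set.

(** * Worst-case probability over the Wasserstein ball *)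

Section robust_feasibility.
Context {R : realType} {K L N P : nat}.
Variables (nrm : 'rV[R]_K -> R) (xi : 'I_N -> 'rV[R]_K).
Variables (eps theta : R).
Variables (a : 'I_P -> 'rV[R]_L) (b : 'I_P -> 'rV[R]_K) (d : 'I_P -> R).
Variables (x : 'rV[R]_L) (p0 : 'I_P).
Hypotheses (nrmP : is_norm nrm) (b_neq0 : forall p, b p != 0).

Notation unsafe := (~` safety_set a b d x).
Notation dist := (unsafe_dist nrm a b d x p0).

(* If [w.2] is unsafe, then [t <= |w.1 - w.2| + max 0 (t - dist w.1)] for
   every pair [w]; this is integrated against a coupling. *)
Lemma unsafe_prob_le (Q : probability (borelRV R K) R) t :
  0 <= t -> ambiguity_set nrm xi theta Q ->
  (t%:E * Q unsafe <=
   (theta + \sum_i N%:R^-1 * Num.max 0 (t - dist (xi i)))%:E)%E.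
Proof.
move=> t0 Qamb; set G := \sum_i _.
have mU : measurable unsafe by exact: (measurable_unsafe a d x p0 nrmP b_neq0).
have Qfin : Q unsafe \is a fin_num by exact: fin_num_measure.
rewrite -(fineK Qfin) -EFinM lee_fin -lerBlDr -lee_fin.
(* The Wasserstein distance is an infimum, so the cost of each coupling is bounded from below. *)
apply: le_trans Qamb; apply: le_ereal_inf_tmp => _ [Pi Pi_coupling <-].
pose V : set (borelRV R K * borelRV R K) := snd @^-1` unsafe.
have mV : measurable V by rewrite -[V]setTI; exact: measurable_snd.
pose g (u : borelRV R K) := Num.max 0 (t - dist u).
have mg : measurable_fun [set: borelRV R K] g.
  apply: measurable_maxr => //; apply: measurable_funB => //.
  exact: measurable_unsafe_dist.
have g0 u : 0 <= g u by rewrite le_max lexx.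
pose f (w : borelRV R K * borelRV R K) := t * \1_V w.
have mf : measurable_fun setT f by apply: measurable_funM.
(* [h] stands in for the transport cost: it lies below the cost, satisfies [f <= h + g], and is
   measurable, so that the integral of [h + g] splits. *)
pose h w := Num.max 0 (f w - g w.1).
have mg1 : measurable_fun [set: borelRV R K * borelRV R K] (fun w => g w.1).
  exact: measurableT_comp.
have mh : measurable_fun setT h.
  by apply: measurable_maxr => //; exact: measurable_funB.
have h0 w : 0 <= h w by rewrite le_max lexx.
have fE : (\int[Pi]_w (f w)%:E = (t * fine (Q unsafe))%:E)%E.
  under eq_integral do rewrite EFinM.
  rewrite ge0_integralZl//; last by exact/measurable_EFinP.
  rewrite integral_indic// setIT EFinM fineK//; congr (_ * _)%E.
  by have [_ ] := Pi_coupling _ mU.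
have fst_coupling A : measurable A -> pushforward Pi fst A =
    (\sum_i (N%:R^-1)%:E * \d_(xi i : borelRV R K) A)%E.
  by move=> mA; have [] := Pi_coupling _ mA.
have gG : (\int[Pi]_w (g w.1)%:E <= G%:E)%E.
  rewrite -(@ge0_integral_pushforward _ _ _ _ _ fst _ Pi setT (EFin \o g))//.
  - exact: integral_finitely_supported_le.
  - exact/measurable_EFinP.
  - by move=> u _; rewrite /= lee_fin.
rewrite EFinB leeBlDr// -fE.
apply: (@le_trans _ _ (\int[Pi]_w ((h w)%:E + (g w.1)%:E))%E).
  apply: ge0_le_integral_nonmeasurable => w.
    by rewrite lee_fin mulr_ge0.
  by rewrite -EFinD lee_fin -lerBlDr le_max lexx orbT.
rewrite ge0_integralD//; last 4 first.
- by move=> w _; rewrite lee_fin.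
- exact/measurable_EFinP.
- by move=> w _; rewrite lee_fin.
- exact/measurable_EFinP.
rewrite leeD// ge0_le_integral_nonmeasurable// => w; rewrite lee_fin//.
rewrite ge_max is_norm_ge0//= /f indicE.
have [|wV] := boolP (w \in V); last first.
  by rewrite mulr0 sub0r (le_trans _ (is_norm_ge0 nrmP _))// oppr_le0.
rewrite inE mulr1 => wU; have := unsafe_dist_le p0 nrmP b_neq0 w.1 wU.
have : t - dist w.1 <= g w.1 by rewrite le_max lexx orbT.
by lra.
Qed.

(** The transport plan moves the fraction [al i] of the mass of [xi i] to [zeta i] and leaves the
    rest. In the index set ['I_N * bool], [true] marks the moved part. *)
Lemma exists_ambiguous (al : 'I_N -> R) (zeta : 'I_N -> 'rV[R]_K) :
  (0 < N)%N -> (forall i, 0 <= al i <= 1) -> (forall i, unsafe (zeta i)) ->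
  \sum_i al i * nrm (xi i - zeta i) <= theta * N%:R ->
  exists2 Q, ambiguity_set nrm xi theta Q &
             ((N%:R^-1 * \sum_i al i)%:E <= Q unsafe)%E.
Proof.
move=> N0 al01 zetaU cost.
have NR : 0 < N%:R :> R by rewrite ltr0n.
pose w (j : 'I_N * bool) := N%:R^-1 * (if j.2 then al j.1 else 1 - al j.1).
pose z (j : 'I_N * bool) : borelRV R K := if j.2 then zeta j.1 else xi j.1.
pose y j : borelRV R K * borelRV R K := (xi j.1 : borelRV R K, z j).
have w0 j : 0 <= w j.
  rewrite /w mulr_ge0 ?invr_ge0//; have /andP[] := al01 j.1.
  by case: ifP => // _; lra.
have sumE (V : nmodType) (F : 'I_N * bool -> V) :
    \sum_j F j = \sum_i (F (i, true) + F (i, false)).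
  under [RHS]eq_bigr => i _ do rewrite -(big_bool _ (fun c => F (i, c))).
  by rewrite pair_bigA; apply: eq_bigr => -[].
have w1 : \sum_j w j = 1.
  rewrite sumE (eq_bigr (fun=> N%:R^-1)).
    by rewrite sumr_const card_ord -(mulr_natr N%:R^-1) mulVf// gt_eqF.
  by move=> i _; rewrite /w/=; ring.
have [Pi PiE] := exists_finitely_supported y w0 w1.
have [Q QE] := exists_finitely_supported z w0 w1.
exists Q.
  rewrite /ambiguity_set/= /wasserstein1.
  apply: (@le_trans _ _ (\int[Pi]_w (nrm ((w.1 : 'rV[R]_K) - w.2))%:E)%E).
    apply: ereal_inf_lbound; exists Pi => // A mA.
    split; rewrite /pushforward PiE ?QE//= /empirical sumE.
    apply: eq_bigr => i _; rewrite -ge0_muleDl ?lee_fin//.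
    by rewrite -EFinD /w/= -mulrDr addrC subrK mulr1.
  rewrite (le_trans (integral_finitely_supported_le w0 (fun A _ => PiE A)
    (fun u => is_norm_ge0 nrmP (u.1 - u.2))))//.
  rewrite lee_fin sumE -(@ler_pM2r _ N%:R)// (le_trans _ cost)//.
  rewrite mulr_suml ler_sum// => i _; rewrite /w/= subrr is_norm0// mulr0 addr0.
  by rewrite mulrAC [N%:R^-1 * _]mulrC mulfVK ?gt_eqF.
(* Mass left in place may be unsafe too, hence only an inequality. *)
rewrite QE mulr_sumr -sumEFin.
rewrite sumE lee_sum// => i _; rewrite {1}/w {1}/z/= diracE mem_set// mule1.
by rewrite leeDl// mule_ge0// lee_fin.
Qed.

(** Forward, robustness is the hypothesis of knapsack duality with [E = eps * N] and
    [Th = theta * N], through adversarial distributions. Backward, the integrated bound is divided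
    by [t]. *)
Lemma robust_thresholdP : (0 < N)%N -> 0 < eps -> eps < 1 -> 0 < theta ->
  (forall Q, ambiguity_set nrm xi theta Q -> (Q unsafe <= eps%:E)%E) <->
  exists2 t, 0 <= t &
    theta + N%:R^-1 * \sum_i Num.max 0 (t - dist (xi i)) <= eps * t.
Proof.
move=> N0 eps0 eps1 theta0.
have NR : 0 < N%:R :> R by rewrite ltr0n.
split=> [robust|[t t0 tP] Q Qamb].
  have [||||t t0 tP] := @knapsack_duality _ _ (fun i => dist (xi i))
      (eps * N%:R) (theta * N%:R).
  - by move=> i; exact: unsafe_dist_ge0.
  - by rewrite mulr_ge0 ?ltW.
  - by rewrite card_ord gtr_pMl.
  - move=> al al01 cost.
    (* [e] is the unspent transport budget per sample; overshooting each distance by at most [e]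
       keeps the total within [theta * N]. *)
    pose e := theta - N%:R^-1 * \sum_i al i * dist (xi i).
    have e0 : 0 < e by rewrite subr_gt0 ltr_pdivrMl// mulrC.
    have zetaP i : exists v, unsafe v /\ nrm (xi i - v) <= dist (xi i) + e.
      have [v] := unsafe_dist_adherent a d x p0 nrmP b_neq0 (xi i) e0.
      by exists v.
    have [zeta zetaU] := choice zetaP.
    have [|Q Qamb alQ] := @exists_ambiguous al zeta N0 al01 (fun i => (zetaU i).1).
      apply: (@le_trans _ _ (\sum_i (al i * dist (xi i) + e))).
        apply: ler_sum => i _; have /andP[al0 al1] := al01 i.
        rewrite (le_trans (ler_wpM2l al0 (zetaU i).2))// mulrDr lerD2l.
        by rewrite ler_piMl// ltW.
      rewrite big_split/= sumr_const card_ord -(mulr_natr e) /e mulrBl.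
      by rewrite mulrAC mulVf ?gt_eqF// mul1r addrC subrK.
    have := le_trans alQ (robust Q Qamb).
    by rewrite lee_fin ler_pdivrMl// mulrC.
  exists t => //; rewrite -(ler_pM2r NR) mulrDl mulrAC mulVf ?gt_eqF// mul1r.
  by rewrite mulrAC.
(* [theta > 0] excludes [t = 0]. *)
have t_gt0 : 0 < t.
  rewrite -(pmulr_rgt0 _ eps0) (lt_le_trans _ tP)// ltr_wpDr//.
  rewrite mulr_ge0 ?invr_ge0 ?ler0n// sumr_ge0// => i _.
  by rewrite le_max lexx.
have := unsafe_prob_le t0 Qamb; rewrite -mulr_sumr => Qle.
rewrite -(@lee_pmul2l _ t%:E)//.
by rewrite (le_trans Qle)// -EFinM lee_fin [t * eps]mulrC.
Qed.

End robust_feasibility.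

(** * Mixed-integer encoding of the threshold condition *)

(* Any feasible [z] gives [t - r_i <= dist (xi i)]. Conversely, one takes
   [r_i = max 0 (t - dist (xi i))] and flags the unsafe samples by [z]. *)
Lemma mip_constraintsP (R : realType) (K L N P : nat)
    (nrm : 'rV[R]_K -> R) (xi : 'I_N -> 'rV[R]_K) (eps theta M : R)
    (a : 'I_P -> 'rV[R]_L) (b : 'I_P -> 'rV[R]_K) (d : 'I_P -> R)
    (X : set 'rV[R]_L) (x : 'rV[R]_L) (p0 : 'I_P) :
  (0 < N)%N -> 0 < theta ->
  sufficiently_large X nrm xi M a b d -> X x ->
  is_norm nrm -> (forall p, b p != 0) ->
  (exists z r t, mip_constraints nrm xi eps theta M a b d z r t x) <->
  exists2 t, 0 <= t &
    theta + N%:R^-1 * \sum_i Num.max 0 (t - unsafe_dist nrm a b d x p0 (xi i))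
      <= eps * t.
Proof.
move=> N0 theta0 [M0 M_large] Xx nrmP b_neq0; set D := unsafe_dist _ _ _ _ _ _.
have NR : 0 < N%:R :> R by rewrite ltr0n.
split=> [[z [r [t [[r0 t0] budget [gate capped] _ safe]]]]|[t t0 tP]].
  exists t => //; rewrite (le_trans _ budget)// lerD2l ler_wpM2l ?invr_ge0//.
  apply: ler_sum => i _; rewrite ge_max r0/=.
  have [p Dp] := unsafe_dist_attained nrm a b d x p0 (xi i).
  have D0 := unsafe_dist_ge0 nrm a b d x p0 (xi i).
  rewrite -/D in Dp D0 *.
  have := gate i; have := safe i p; have := capped i p.
  rewrite -/(margin nrm a b d x (xi i) p).
  (* A flagged sample has [t - r_i <= 0] by [gate]. Otherwise the margin of the closest constraint
     is nonnegative, hence equal to [D], and bounds [t - r_i]. *)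
  case: (z i); rewrite /= ?subrr ?subr0 ?mulr0 ?mulr1 ?addr0; first by lra.
  by move=> cap margin0; rewrite Dp max_r//; lra.
have D0 i : 0 <= D (xi i) by exact: unsafe_dist_ge0.
have D_margin i p : 0 < D (xi i) -> D (xi i) <= margin nrm a b d x (xi i) p.
  by move=> Di; have := unsafe_dist_le_margin nrm a b d x p0 (xi i) p;
    rewrite -/D le_max leNgt Di.
have marginM i p : `|margin nrm a b d x (xi i) p| <= M.
  have bp := dual_norm_gt0 nrmP (b_neq0 p).
  by rewrite normrM normfV (gtr0_norm bp); exact: M_large.
pose r i := Num.max 0 (t - D (xi i)).
have r0 i : 0 <= r i by rewrite le_max lexx.
have rD i : t - r i <= D (xi i).
  by have : t - D (xi i) <= r i by [rewrite le_max lexx orbT]; lra.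
exists [ffun i => (D (xi i) <= 0)%R], (\row_i r i), t; split.
- by split=> // i; rewrite mxE.
- by under eq_bigr do rewrite mxE.
- split=> i => [|p]; rewrite ffunE mxE (le_trans (rD i))//.
    have [Di|Di] := leP (D (xi i)) 0; first by rewrite subrr mulr0.
    rewrite subr0 mulr1 (le_trans (D_margin i p0 Di))//.
    exact: le_trans (ler_norm _) (marginM i p0).
  rewrite -/(margin nrm a b d x (xi i) p).
  have [Di|Di] := leP (D (xi i)) 0; last by rewrite mulr0 addr0 D_margin.
  by have := marginM i p; rewrite ler_norml mulr1; lra.
- under eq_bigr do rewrite ffunE.
  (* Each flagged sample has [r_i >= t], so [c * t <= eps * N * t - theta * N]. Dividing by [t > 0]
     gives [c <= eps * N], and [c] is an integer. *)
  rewrite -natr_sum; set c := (\sum_i _)%N.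
  rewrite -[c%:R]/(c%:Z%:~R) ler_int floor_ge_int -[c%:Z%:~R]/(c%:R).
  have ct : c%:R * t <= \sum_i r i.
    rewrite /c natr_sum mulr_suml ler_sum// => i _.
    have [Di|_] := leP (D (xi i)) 0; last by rewrite mul0r.
    by rewrite mul1r /r le_max; apply/orP; right; lra.
  have tP' : theta * N%:R + \sum_i r i <= eps * N%:R * t.
    rewrite -(ler_pM2r NR) mulrDl mulrAC mulVf ?gt_eqF// mul1r in tP.
    by rewrite mulrAC.
  have t_gt0 : 0 < t.
    rewrite lt_neqAle t0 andbT; apply/eqP => t00.
    by move: tP' ct; rewrite -t00 !mulr0; have := mulr_gt0 theta0 NR; lra.
  rewrite -(ler_pM2r t_gt0); have := mulr_gt0 theta0 NR; lra.
- move=> i p; rewrite ffunE -/(margin nrm a b d x (xi i) p).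
  have [Di|Di] := leP (D (xi i)) 0.
    by have := marginM i p; rewrite ler_norml mulr1; lra.
  by rewrite mulr0 addr0 (le_trans _ (D_margin i p Di))// ltW.
Qed.

(** * Projection of minimization problems and the exact reformulation *)

(** The objective factors through [pr], so both problems attain the same values, and any preimage in
    [F] of a minimizer over [G] is a minimizer. *)
Lemma minimization_projection (R : realType) (S T : Type) (F : set S)
    (G : set T) (pr : S -> T) (f : T -> R) :
  [set pr w | w in F] = G ->
  optimal_value F (f \o pr) = optimal_value G f /\
  [set pr w | w in minimizers F (f \o pr)] = minimizers G f.
Proof.
move=> <-; split.
  congr ereal_inf; apply/seteqP; split=> [_ [w Fw <-]|_ [_ [w Fw <-] <-]].
    by exists (pr w) => //; exists w.
  by exists w.
apply/seteqP; split=> [_ [w [Fw wmin] <-]|_ [[w Fw <-] wmin]].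
  by split=> [|_ [v Fv <-]]; [exists w|exact: wmin].
exists w => //; split=> // v Fv.
by apply: wmin; exists v.
Qed.

Theorem theorem1 (R : realType) (K L N P : nat)
    (K_gt0 : (0 < K)%N) (L_gt0 : (0 < L)%N)
    (N_gt0 : (0 < N)%N) (P_gt0 : (0 < P)%N)
    (X : set 'rV[R]_L) (X_compact : compact X)
    (nrm : 'rV[R]_K -> R) (nrm_norm : is_norm nrm)
    (xi : 'I_N -> 'rV[R]_K)
    (eps : R) (eps_gt0 : 0 < eps) (eps_lt1 : eps < 1)
    (theta : R) (theta_gt0 : 0 < theta)
    (a : 'I_P -> 'rV[R]_L) (b : 'I_P -> 'rV[R]_K) (b_neq0 : forall p, b p != 0)
    (d : 'I_P -> R)
    (M : R) (M_large : sufficiently_large X nrm xi M a b d) :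
  let XDR := dr_feasible X nrm xi eps theta a b d in
  let MIP := mip_feasible X nrm xi eps theta M a b d in
  XDR = [set x | X x /\ exists (z : {ffun 'I_N -> bool}) (r : 'rV[R]_N) (t : R),
                   mip_constraints nrm xi eps theta M a b d z r t x] /\
  (forall c : 'rV[R]_L,
     let obj := fun w : mip_vars => dot c w.2 in
     optimal_value MIP obj = optimal_value XDR (dot c) /\
     [set w.2 | w in minimizers MIP obj] = minimizers XDR (dot c)).
Proof.
move=> XDR MIP; pose p0 : 'I_P := Ordinal P_gt0.
have XDRE : XDR = [set x | X x /\ exists (z : {ffun 'I_N -> bool})
    (r : 'rV[R]_N) (t : R), mip_constraints nrm xi eps theta M a b d z r t x].
  apply/seteqP; split=> x /= [Xx xP]; split=> //.
    apply: (iffRL (mip_constraintsP eps p0 N_gt0 theta_gt0 M_large Xx nrm_norm b_neq0)).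
    apply/(robust_thresholdP xi a d x p0 nrm_norm) => // Q Qamb.
    by apply: le_trans xP; apply: ereal_sup_ubound; exists Q.
  apply: ge_ereal_sup => _ [Q Qamb <-]; move: Q Qamb.
  apply/(robust_thresholdP xi a d x p0 nrm_norm) => //.
  exact: (iffLR (mip_constraintsP eps p0 N_gt0 theta_gt0 M_large Xx nrm_norm b_neq0) xP).
(* Tuples nest to the left, so [w.2] is the component [x]. *)
split=> // c; apply: minimization_projection; rewrite XDRE.
apply/seteqP; split=> [_ [[[[z r] t] x] /= [Xx zrt] <-]|x [Xx [z [r [t zrt]]]]].
  by split=> //; exists z, r, t.
by exists (z, r, t, x).
Qed.
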